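(* Let $\tau$ be the usual product topology on $\mathbb R\times\mathbb R$ and let $\mu$ be a $\mathcal C$-cross topology on $\mathbb R\times\mathbb R$ such that the family $\mathcal C$ contains a $\pi$-base for $\tau$. If $X\subseteq\mathbb R$ is not meager in $\mathbb R$, then the square $X\times X$ is not a meager subset of $\mathbb R\times\mathbb R$ with respect to $\mu$. Moreover, $\mathrm{non}(\mathcal M_\mu)=\mathrm{non}(\mathcal M_{\mathbb R})$, where $\mathcal M_\mu$ is the $\sigma$-ideal of $\mu$-meager subsets of $\mathbb R\times\mathbb R$ and $\mathcal M_{\mathbb R}$ is the $\sigma$-ideal of meager subsets of $\mathbb R$ with its usual topology.
   Context: For $G\subseteq\mathbb R\times\mathbb R$, $G_x=\{y:(x,y)\in G\}$ and $G^y=\{x:(x,y)\in G\}$ denote the vertical and horizontal sections. $\mathcal C$-cross topology on $\mathbb R\times\mathbb R$: let $\mathcal C$ be a family of subsets of $\mathbb R\times\mathbb R$ which is closed under finite intersections and such that for each $G\in\mathcal C$ every non-empty vertical section $G_x$ and every non-empty horizontal section $G^y$ has non-empty interior in $\mathbb R$ (with its usual topology). The $\mathcal C$-cross topology is the topology on $\mathbb R\times\mathbb R$ generated by $\mathcal C$, for which $\mathcal C$ is a base. A $\pi$-base for a topology is a family of non-empty open sets such that every non-empty open set contains a member of the family. For a family $\mathcal F$ of subsets of a set $Z$ with $Z=\bigcup\mathcal F$, $\mathrm{non}(\mathcal F)$ is the minimal cardinality of a subset $Y\subseteq Z$ with $Y\notin\mathcal F$. *)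

(* Defs.v *)
From HB Require Import structures.
From mathcomp Require Import all_boot all_order all_algebra.
From mathcomp Require Import all_classical all_reals all_analysis.

Set Implicit Arguments.
Unset Strict Implicit.
Unset Printing Implicit Defensive.
Import Order.TTheory GRing.Theory Num.Theory.
Import numFieldNormedType.Exports.

Local Open Scope classical_set_scope.

Section category.
Context {T : topologicalType}.

Definition nowhere_dense (A : set T) := (closure A)° = set0.

Definition meager (A : set T) :=
  exists F : nat -> set T,
    (forall n, nowhere_dense (F n)) /\ A = \bigcup_n F n.

Definition pi_base (P : set (set T)) :=
  (forall A, P A -> open A /\ A !=set0) /\
  (forall U, open U -> U !=set0 -> exists2 A, P A & A `<=` U).

End category.

(* There is no type of cardinal numbers: non(F) is represented by a set Y that
   attains it.  Such a Y is unique up to equipotence, so non(F) = non(G) is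
   expressed by Y #= Y' for representatives Y and Y'. *)
Definition attains_non {Z : Type} (F : set (set Z)) (Y : set Z) :=
  [/\ \bigcup_(A in F) A = setT, ~ F Y &
      forall Y' : set Z, ~ F Y' -> (Y #<= Y')%card].

Section cross_topology.
Context {R : realType}.

(* The covering condition is what makes C a base, and not only a subbase, of
   the topology that it generates (see basis_cross_space). *)
Definition cross_family (C : set (set (R * R))) :=
  [/\ setI_closed C,
      \bigcup_(G in C) G = setT &
      forall G, C G ->
        (forall x, xsection G x !=set0 -> (xsection G x)° !=set0) /\
        (forall y, ysection G y !=set0 -> (ysection G y)° !=set0)].

(* The plane with the topology generated by C, instead of the product
   topology carried by R * R. *)
Definition cross_space (C : set (set (R * R))) : Type := (R * R)%type.

HB.instance Definition _ C := Choice.on (cross_space C).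
HB.instance Definition _ C :=
  isSubBaseTopological.Build (cross_space C) C id.

Lemma basis_cross_space (C : set (set (R * R))) :
  cross_family C -> basis (C : set (set (cross_space C))).
Proof.
move=> [CI Ccov _].
have Cop (G : set (cross_space C)) : C G -> open G.
  move=> CG; exists [set G]; last by rewrite bigcup_set1.
  by move=> _ ->; exact: finI_from1.
split=> // p A; rewrite /= nbhsE => -[B [[D DC <-] [E DE Ep]] BA].
have /DC[fs fsC EE] := DE.
have capC (s : seq (set (R * R))) : (forall H, H \in s -> C H /\ H p) ->
    exists G, [/\ C G, G p & forall H, H \in s -> G `<=` H].
  elim: s => [_|H s IH Hs].
    have : [set: R * R] p by [].
    by rewrite -Ccov => -[G CG Gp]; exists G.
  have [|G [CG Gp Gs]] := IH.
    by move=> x xs; apply: Hs; rewrite in_cons xs orbT.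
  have [CH Hp] : C H /\ H p by apply: Hs; rewrite in_cons eqxx.
  exists (H `&` G); split=> //; first exact: CI.
  move=> K; rewrite in_cons => /orP[/eqP ->|/Gs GK] q [] //.
  by move=> _ /GK.
have [|G [CG Gp Gs]] := capC (finmap.enum_fset fs).
  move=> H Hfs; split; first by have := fsC _ Hfs; rewrite inE.
  by move: Ep; change (E p -> H p); rewrite -EE; apply.
exists G => //; apply: subset_trans BA => q Gq; exists E => //.
by change (E q); rewrite -EE => H Hfs; exact: (Gs H Hfs q Gq).
Qed.

End cross_topology.

(* Main.v *)
Require Import Defs.
From HB Require Import structures.
From mathcomp Require Import all_boot all_order all_algebra.
From mathcomp Require Import all_classical all_reals all_analysis.
Import numFieldNormedType.Exports.

Set Implicit Arguments.
Unset Strict Implicit.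
Unset Printing Implicit Defensive.

Local Open Scope classical_set_scope.
Local Open Scope card_scope.

(* If F is mu-nowhere dense, then every rectangle U x V contains a non-empty H
   in C that misses F; H projects onto a set with interior and its vertical
   sections have interior, so F_x cannot be dense in V for all x in a dense
   subset of U.  Hence all but a meager set of the vertical sections of a
   mu-meager set are meager, which settles squares.  Conversely, by Baire's
   theorem each non-empty G in C is dense in some open rectangle, so N x R is
   mu-nowhere dense when N is nowhere dense in R, and a non-mu-meager set has a
   non-meager projection.  If Y is non-meager of minimal cardinality, then Y x Y
   is non-mu-meager of minimal cardinality, and Y x Y is equipotent to Y. *)

(** * Cardinal arithmetic: least cardinals and squares of infinite sets *)

Lemma card_leE (T : Type) (U : pointedType) (A : set T) (B : set U) :
  (A #<= B) <-> exists f : T -> U, (forall x, A x -> B (f x)) /\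
    (forall x y, A x -> A y -> f x = f y -> x = y).
Proof.
split=> [/pcard_leP/injfunPex[f fAB finj]|[f [fAB finj]]].
  by exists f; split=> // x y Ax Ay; apply: finj; exact: mem_set.
apply/pcard_leP/injfunPex; exists f => // x y xA yA; apply: finj; exact: set_mem.
Qed.

(* Zorn's lemma for sets S of selectors of the family D that are injective
   coordinatewise: a maximal S exhausts some A in D. *)
Lemma card_le_min (T : Type) (D : set (set T)) : D !=set0 ->
  exists2 A, D A & forall B, D B -> A #<= B.
Proof.
move=> [A0 DA0].
pose P (S : set (set T -> T)) := forall B, D B ->
  (forall f, S f -> B (f B)) /\
  (forall f g, S f -> S g -> f B = g B -> f = g).
have [F FP Ftot|S [PS maxS]] := @Zorn_bigcup _ P.
  move=> B DB; split=> [f [S FS Sf]|f g [S FS Sf] [S' FS' S'g]].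
    exact: (FP _ FS _ DB).1.
  have [SS'|S'S] := Ftot _ _ FS FS'.
    by apply: (FP _ FS' _ DB).2 => //; exact: SS'.
  by apply: (FP _ FS _ DB).2 => //; exact: S'S.
have [[A [DA SA]]|noA] := pselect (exists A, D A /\ A `<=` (fun f => f A) @` S).
  (* Evaluation at [A] maps [S] onto a superset of [A], and evaluation at [B] embeds [S] into
     [B]. *)
  exists A => // B DB; apply: card_le_trans (subset_card_le SA) _.
  apply: card_le_trans (card_image_le _ _) _.
  have SB : (fun f => f B) @` S #= S.
    by apply: inj_card_eq => f g /set_mem Sf /set_mem Sg; exact: (PS _ DB).2.
  rewrite -(card_le_eql SB); apply: subset_card_le => _ [f Sf <-].
  exact: (PS _ DB).1.
(* Otherwise each [B] in [D] has a point that no selector in [S] takes, and a choice [h] of such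
   points can be adjoined to [S]. For [B] outside [D] any point of [A0] will do: an empty [A0] would
   be trivially exhausted. *)
have exh B : exists b, D B -> B b /\ ~ ((fun f => f B) @` S) b.
  have [DB|nDB] := pselect (D B); last first.
    have [a _] : A0 !=set0.
      apply/set0P/negP => /eqP A00; apply: noA; exists A0; split => //.
      by rewrite A00.
    by exists a.
  have /existsNP[b /not_implyP[Bb nb]] : ~ B `<=` (fun f => f B) @` S.
    by move=> BS; apply: noA; exists B.
  by exists b.
have [h hP] := choice exh.
have Sh : ~ S h.
  by move=> Sh; have [_] := hP _ DA0; apply; exists h.
have [] := maxS (S `|` [set h]).
  split; first exact: subsetUl.
  by move=> /(_ h) hS; apply: Sh; apply: hS; right.
move=> B DB; have [hB nhB] := hP _ DB; split=> [f [Sf|->//]|f g].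
  exact: (PS _ DB).1.
move=> [Sf|->] [Sg|->] // fg; first exact: (PS _ DB).2.
  by case: nhB; exists f.
by case: nhB; exists g.
Qed.

(** The union embeds into [A * A] as two disjoint copies, over distinct first coordinates [g 0] and
    [g 1]. *)
Lemma card_leU_infinite (T : pointedType) (A B : set T) :
  infinite_set A -> A `*` A #<= A -> B #<= A -> A `|` B #<= A.
Proof.
move=> Ainf AA /card_leE[f [fBA finj]].
have /infiniteP/card_leE[g [gA ginj]] := Ainf.
have A01 : A (g 0%N) /\ A (g 1%N) by split; exact: gA.
have g01 : g 0%N <> g 1%N by move=> /(ginj _ _ I I).
apply: card_le_trans AA.
apply/card_leE; exists (fun x => if pselect (A x) then (g 0%N, x)
  else (g 1%N, f x)); split=> [x ABx|x y ABx ABy].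
  case: pselect => [Ax|nAx]; split => //=; try by case: A01.
  by case: ABx => // /fBA.
case: pselect => [Ax|nAx]; case: pselect => [Ay|nAy] => -[] //.
- by move=> /esym.
- move=> fxy; case: ABx => // Bx; case: ABy => // By; exact: finj.
Qed.

Lemma card_leX2 (T U V W : pointedType) (A : set T) (B : set U) (A' : set V)
    (B' : set W) : A #<= A' -> B #<= B' -> A `*` B #<= A' `*` B'.
Proof.
move=> /card_leE[f [fA finj]] /card_leE[g [gB ginj]].
apply/card_leE; exists (fun p => (f p.1, g p.2)); split=> [p [/fA ? /gB ?] //|].
by move=> [x y] [x' y'] [/= ? ?] [/= ? ?] [/finj -> // /ginj ->].
Qed.

(* Zorn's lemma for the graphs S of (possibly multivalued) injections of A * A
   into A, where A `<=` X is the set of points on whose diagonal S is defined. *)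
Lemma card_setX_infinite (T : pointedType) (X : set T) :
  infinite_set X -> X `*` X #= X.
Proof.
move=> Xinf.
pose fld (S : set (T * T * T)) := [set x | exists z, S (x, x, z)].
pose graph (S : set (T * T * T)) := [/\ fld S `<=` X,
  (forall x y z, S (x, y, z) -> [/\ fld S x, fld S y & fld S z]),
  (forall x y, fld S x -> fld S y -> exists z, S (x, y, z)) &
  (forall p q z, S (p, z) -> S (q, z) -> p = q)].
have /infiniteP/card_leE[g [gX ginj]] := Xinf.
(* The pairing of natural numbers, transported along [g], starts the extension and keeps the field
   infinite. *)
pose S0 := [set p : T * T * T |
  exists m n, p = (g m, g n, g (pickle (m, n)))].
have fldS0 : fld S0 = range g.
  apply/seteqP; split=> [x [_ [m [n [-> _ _]]]]|_ [n _ <-]]; first by exists m.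
  by exists (g (pickle (n, n))), n, n.
have graphS0 : graph S0.
  split; rewrite ?fldS0.
  - by move=> _ [n _ <-]; exact: gX.
  - by move=> x y z [m [n [-> -> ->]]]; split; eexists.
  - by move=> _ _ [m _ <-] [n _ <-]; exists (g (pickle (m, n))), m, n.
  - move=> p q z [m [n [-> ->]]] [m' [n' [-> /(ginj _ _ I I)]]].
    by move=> /(pcan_inj pickleK) [-> ->].
have fld_inf : infinite_set (fld S0).
  by rewrite fldS0; apply/infiniteP/card_leE; exists g; split=> // x _; exists x.
have fldS S S' : S `<=` S' -> fld S `<=` fld S'.
  by move=> SS' x [z Sz]; exists z; exact: SS'.
(* The alternative [S = set0] is there for the empty chain, whose union is empty; line by line
   maximality then rules it out, since [S0] is a proper extension of the empty set. *)
have [F FP Ftot|S [[PS PS0] maxS]] :=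
    @Zorn_bigcup _ [set S | graph S /\ (S = set0 \/ S0 `<=` S)].
  have fldF x : fld (\bigcup_(S in F) S) x -> exists2 S, F S & fld S x.
    by move=> [z [S FS Sz]]; exists S => //; exists z.
  have sFld S : F S -> fld S `<=` fld (\bigcup_(S in F) S).
    by move=> FS; apply: fldS => p Sp; exists S.
  split; last first.
    have [[S FS S0S]|noS] := pselect (exists2 S, F S & S0 `<=` S).
      by right; apply: subset_trans S0S _ => p Sp; exists S.
    left; apply/seteqP; split=> // p [S FS Sp].
    have [_ [Se|S0S]] := FP _ FS; first by move: Sp; rewrite Se.
    by case: noS; exists S.
  split.
  - by move=> x /fldF[S FS]; have [[SX _ _ _] _] := FP _ FS; exact: SX.
  - move=> x y z [S FS Sp]; have [[_ cl _ _] _] := FP _ FS.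
    by have [] := cl _ _ _ Sp; split; exact: (sFld S).
  - move=> x y /fldF[S FS Sx] /fldF[S' FS' Sy].
    have [SS'|S'S] := Ftot _ _ FS FS'.
      have [[_ _ tot _] _] := FP _ FS'.
      by have [z] := tot _ _ (fldS _ _ SS' _ Sx) Sy; exists z, S'.
    have [[_ _ tot _] _] := FP _ FS.
    by have [z] := tot _ _ Sx (fldS _ _ S'S _ Sy); exists z, S.
  - move=> p q z [S FS Sp] [S' FS' Sq].
    have [SS'|S'S] := Ftot _ _ FS FS'.
      have [[_ _ _ inj] _] := FP _ FS'; exact: inj (SS' _ Sp) Sq.
    have [[_ _ _ inj] _] := FP _ FS; exact: inj Sp (S'S _ Sq).
have S0S : S0 `<=` S.
  case: PS0 => // S_e; case: (maxS S0); last by split => //; right.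
  rewrite S_e; split=> // /(_ (g 0%N, g 0%N, g (pickle (0%N, 0%N)))) [].
  by exists 0%N, 0%N.
case: PS => AX clS totS injS; set A := fld S in AX clS totS.
have Ainf : infinite_set A by apply: sub_infinite_set fld_inf; exact: fldS.
have AA : A `*` A #<= A.
  have /choice[f fP] : forall p : T * T, exists z, A p.1 -> A p.2 -> S (p, z).
    move=> [x y]; have [[Ax Ay]|nA] := pselect (A x /\ A y).
      by have [z] := totS _ _ Ax Ay; exists z.
    by exists point => ? ?; case: nA.
  apply/card_leE; exists f; split=> [[x y] [/= Ax Ay]|[x y] [x' y']].
    by have [] := clS _ _ _ (fP (x, y) Ax Ay).
  move=> [/= Ax Ay] [/= Ax' Ay'] ff; apply: (injS _ _ (f (x, y))).
    exact: fP.
  by rewrite ff; exact: fP.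
have AUX : A `|` (X `\` A) = X by rewrite setDUK.
(* If the complement of [A] in [X] embeds into [A], the union bound suffices. Otherwise it contains
   a copy [B] of [A], and [S] is extended to the field [A] together with [B], against maximality. *)
have XA : X #<= A.
  have [|M MP Mmin] := @card_le_min _ [set A; X `\` A]; first by exists A; left.
  have [AM|AXA] : X `\` A #<= A \/ A #<= X `\` A.
    by case: MP => ME; rewrite ME in Mmin; [right|left]; apply: Mmin; [right|left].
    by rewrite -AUX; exact: card_leU_infinite.
  have /card_leE[f [fXA finj]] := AXA.
  pose B := f @` A.
  have ABA : A `|` B #<= A.
    by apply: card_leU_infinite => //; exact: card_image_le.
  have /card_leE[e [eA einj]] : (A `|` B) `*` (A `|` B) #<= A.
    by apply: card_le_trans AA; exact: card_leX2.
  pose AB2 := (A `|` B) `*` (A `|` B).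
  (* The new pairs get values in [B], by [e] followed by [f]. Since [S] takes its values in [A],
     which is disjoint from [B], old and new values never collide. *)
  pose S' := S `|` [set p | [/\ AB2 p.1, ~ (A `*` A) p.1 & p.2 = f (e p.1)]].
  have nAB x : A x -> B x -> False.
    by move=> Ax [y Ay yx]; case: (fXA _ Ay); rewrite yx.
  have fldS' : fld S' = A `|` B.
    apply/seteqP; split=> [x [z [Sz|[[]]//]]|x ABx]; first by left; exists z.
    have [Ax|nAx] := pselect (A x); first by apply: (fldS S S') => // ? ?; left.
    by exists (f (e (x, x))); right; split=> //= -[].
  case: (maxS S'); first split; first by move=> ? ?; left.
    have [a Aa] := infinite_setN0 Ainf.
    have Bfa : B (f a) by exists a.
    move=> /(_ (f a, f a, f (e (f a, f a)))) S'S.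
    case: (nAB (f a)) => //; exists (f (e (f a, f a))); apply: S'S; right.
    by split=> //=; [split; right|case=> /nAB].
  split; last by right; apply: subset_trans S0S _; exact: subsetUl.
  rewrite /graph fldS'; split.
  - by move=> x [/AX//|[a /fXA[Xfa _] <-]].
  - move=> x y z [/clS[Ax Ay Az]|[[/= ABx ABy] _ ->]]; first by split; left.
    by split=> //; right; exists (e (x, y)) => //; exact: eA.
  - move=> x y ABx ABy; have [[Ax Ay]|nA] := pselect ((A `*` A) (x, y)).
      by have [z Sz] := totS _ _ Ax Ay; exists z; left.
    by exists (f (e (x, y))); right.
  - have nS p q z : S (p, z) -> AB2 q -> z = f (e q) -> False.
      case: p => x y /clS[_ _ Az] ABq zE; apply: (nAB z) => //.
      by rewrite zE; exists (e q) => //; exact: eA.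
    move=> p q z [Sp|[/= ABp _ pE]] [Sq|[/= ABq _ qE]].
    + exact: injS Sp Sq.
    + by case: (nS _ _ _ Sp ABq).
    + by case: (nS _ _ _ Sq ABp).
    + by apply: einj => //; apply: finj; [exact: eA|exact: eA|rewrite -pE].
rewrite card_eq_le; apply/andP; split.
  apply: card_le_trans (card_leX2 XA XA) _.
  exact: card_le_trans AA (subset_card_le AX).
have [x Xx] := infinite_setN0 Xinf.
by apply/card_leE; exists (fun y => (y, x)); split=> // y z _ _ [].
Qed.

(** * Nowhere dense and meager sets *)

Lemma nowhere_denseP (T : topologicalType) (A : set T) :
  nowhere_dense A <-> forall U, open U -> U !=set0 -> ~ U `<=` closure A.
Proof.
split=> [A0 U oU [x Ux] UA|nA].
  suff : (closure A)° x by rewrite A0.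
  by apply: (interiorS UA); move/interior_id: oU => ->.
apply/seteqP; split => // x Ax; case: (nA (closure A)°).
- exact: open_interior.
- by exists x.
- exact: interior_subset.
Qed.

Lemma meager_countable_cover (T : topologicalType) (I : countType)
    (F : I -> set T) (A : set T) :
  (forall i, nowhere_dense (F i)) -> A `<=` \bigcup_i F i -> meager A.
Proof.
move=> Fnd AF.
(* Cutting down to [A] turns the cover into the equality that [meager] asks for; numbers that code
   no index contribute the empty set. *)
pose G n := if unpickle n is Some i then A `&` F i else set0.
exists G; split=> [n|].
  apply/nowhere_denseP => U oU U0; rewrite /G; case: (unpickle n) => [i UF|].
    apply: ((nowhere_denseP (F i)).1 (Fnd i) U oU U0).
    by apply: subset_trans UF _; apply: closureS; exact: subIsetr.
  by rewrite closure0; case: U0 => x Ux /(_ _ Ux).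
apply/seteqP; split=> [x Ax|x [n _]]; last first.
  by rewrite /G; case: unpickle => // i [].
have [i _ Fx] := AF _ Ax.
by exists (pickle i) => //; rewrite /G pickleK.
Qed.

Lemma meager_sub (T : topologicalType) (A B : set T) :
  A `<=` B -> meager B -> meager A.
Proof.
by move=> AB [F [Fnd BF]]; apply: (meager_countable_cover Fnd); rewrite -BF.
Qed.

Lemma nonmeager_open (R : realType) (U : set R) :
  open U -> U !=set0 -> ~ meager U.
Proof.
move=> oU U0 [F [Fnd UF]].
have /Baire/(_ U U0 oU)[x [Ux]] : forall n,
    open (~` closure (F n)) /\ dense (~` closure (F n)).
  move=> n; split; first by apply: closed_openC; exact: closed_closure.
  move=> V V0 oV; have /existsNP[x /not_implyP[Vx nFx]] :=
    (nowhere_denseP (F n)).1 (Fnd n) V oV V0.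
  by exists x.
by move: Ux; rewrite UF => -[n _ Fx] /(_ n I); apply; exact: subset_closure.
Qed.

(** Rational radii may be non-positive, so some [J i] are empty; this is why [J i !=set0] is carried
    along. *)
Lemma countable_pi_base (R : realType) : exists J : rat * rat -> set R,
  (forall i, open (J i)) /\
  forall U, open U -> U !=set0 -> exists2 i, J i !=set0 & J i `<=` U.
Proof.
exists (fun p => ball (ratr p.1 : R) (ratr p.2)); split=> [i|U oU [x Ux]].
  exact: ball_open.
have [c [r /= [xB BU]]] := open_subball_rat oU (mem_set Ux).
by exists (c, r) => //; exists x; exact: set_mem.
Qed.

Lemma not_nowhere_dense_pi_base (T : topologicalType) (I : Type)
    (J : I -> set T) (A : set T) :
  (forall U, open U -> U !=set0 -> exists2 i, J i !=set0 & J i `<=` U) ->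
  ~ nowhere_dense A -> exists2 i, J i !=set0 & J i `<=` closure A.
Proof.
move=> Jpi nA; have [||i Ji0 JiA] := Jpi (closure A)°.
- exact: open_interior.
- by apply/set0P/eqP.
- by exists i => //; apply: subset_trans JiA _; exact: interior_subset.
Qed.

(** * Category in the cross topology *)

Section cross.
Context {R : realType} {C : set (set (R * R))}.
Context (crossC : cross_family C).
Context (piC : exists2 P : set (set (R * R)), P `<=` C & pi_base P).

Lemma cross_open G : C G -> open (G : set (cross_space C)).
Proof. by move=> CG; have [+ _] := basis_cross_space crossC; apply. Qed.

Lemma cross_nowhere_denseP (A : set (R * R)) :
  @nowhere_dense (cross_space C) A <->
  forall G, C G -> G !=set0 ->
    exists2 H, C H & [/\ H !=set0, H `<=` G & H `&` A = set0].
Proof.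
have [Cop Cnb] := basis_cross_space crossC; have [CI _ _] := crossC.
split=> [/nowhere_denseP And G CG G0|And].
  have /existsNP[p /not_implyP[Gp nAp]] := And _ (cross_open CG) G0.
  have oA : open (~` closure (A : set (cross_space C))).
    by apply: closed_openC; exact: closed_closure.
  have [] := Cnb p (~` closure (A : set (cross_space C))).
    by apply: open_nbhs_nbhs.
  move=> H [CH Hp] HA; exists (G `&` H); first exact: CI.
  split; first by exists p.
    by move=> ? [].
  apply/seteqP; split=> // q [[_ /HA nq] Aq]; apply: nq.
  exact: (@subset_closure (cross_space C)).
apply/nowhere_denseP => U oU [p Up] UA.
have [G [CG Gp] GU] : filter_from [set V | C V /\ V p] id U.
  by apply: (Cnb p); apply: open_nbhs_nbhs.
have [|H CH [[q Hq] HG HA]] := And G CG; first by exists p.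
have [|r []] := UA q (GU q (HG q Hq)) H.
  by apply: open_nbhs_nbhs; split=> //; exact: cross_open.
by move=> Ar Hr; suff : (H `&` A) r by rewrite HA.
Qed.

(** The pi-base enters here. That [G] is open in the product topology, besides lying in [C], matters
    in [cross_nowhere_dense_setXT]. *)
Lemma cross_subrectangle (U V : set R) : open U -> open V -> U !=set0 ->
  V !=set0 -> exists G, [/\ C G, open G, G !=set0 & G `<=` U `*` V].
Proof.
move=> oU oV [x Ux] [y Vy]; have [P PC [Pop Pex]] := piC.
have [||G PG GUV] := Pex (U `*` V).
- rewrite openE => -[a b] [/= Ua Vb].
  by exists (U, V) => //; split; exact: open_nbhs_nbhs.
- by exists (x, y).
by have [oG G0] := Pop _ PG; exists G; split=> //; exact: PC.
Qed.

(** One direction of a Kuratowski-Ulam theorem. *)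
Lemma cross_meager_sections (Z : set (R * R)) :
  @meager (cross_space C) Z -> meager [set x | ~ meager (xsection Z x)].
Proof.
move=> [F [Fnd ->]]; have [J [oJ Jpi]] := countable_pi_base R.
(* A non-meager section of the union has a piece [F n] whose section is dense in some [J i], so
   countably many sets [E] cover the exceptional points. *)
pose E (i : nat * (rat * rat)) :=
  [set x | J i.2 !=set0 /\ J i.2 `<=` closure (xsection (F i.1) x)].
apply: (@meager_countable_cover _ _ E) => [[n i]|x nZx]; last first.
  have [[n nF]|noF] := pselect (exists n, ~ nowhere_dense (xsection (F n) x)).
    have [i Ji0 JiF] := not_nowhere_dense_pi_base Jpi nF.
    by exists (n, i).
  case: nZx; exists (fun n => xsection (F n) x); split=> [n|].
    by apply: contrapT => nF; apply: noF; exists n.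
  exact: xsection_bigcup.
apply/nowhere_denseP => U oU U0 UE.
have Ji0 : J i !=set0.
  have [x Ux] := U0; have [|y [[]//]] := UE x Ux U.
  exact: open_nbhs_nbhs.
have [G [CG _ G0 GUJ]] := cross_subrectangle oU (oJ i) U0 Ji0.
have [H CH [[[x y] Hp] HG HF]] := (cross_nowhere_denseP _).1 (Fnd n) G CG G0.
have [_ _ /(_ _ CH)[Hx Hy]] := crossC.
have [|x' Hx'] := Hy y; first by exists x; apply/ysectionP.
have HU : (ysection H y)° `<=` U.
  by move=> z /interior_subset/ysectionP/HG/GUJ[].
(* Density of [E] in [U] gives [z] in the horizontal section of [H] with the section of [F n] at [z]
   dense in [J i]. The vertical section of [H] at [z] has interior and lies in [J i], so [H] meets
   [F n]. *)
have [|z [[_ JF] Hz]] := UE x' (HU _ Hx') (ysection H y)°.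
  by apply: open_nbhs_nbhs; split=> //; exact: open_interior.
have [|y' Hy'] := Hx z.
  by exists y; apply/xsectionP/ysectionP; exact: interior_subset.
have Jy' : J i y'.
  by have /xsectionP/HG/GUJ[] := interior_subset Hy'.
have [|w [Fw Hw]] := JF y' Jy' (xsection H z)°.
  by apply: open_nbhs_nbhs; split=> //; exact: open_interior.
suff : (H `&` F n) (z, w) by rewrite HF.
by split; apply/xsectionP => //; exact: interior_subset.
Qed.

Lemma cross_dense_rectangle (G : set (R * R)) : C G -> G !=set0 ->
  exists U V : set R, [/\ open U, open V, U !=set0, V !=set0 &
    forall O, open O -> O !=set0 -> O `<=` U `*` V -> O `&` G !=set0].
Proof.
move=> CG [[x0 y0] Gp]; have [J [oJ Jpi]] := countable_pi_base R.
have [_ _ /(_ _ CG)[Gx Gy]] := crossC.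
pose W := (ysection G y0)°.
have W0 : W !=set0 by apply: Gy; exists x0; apply/ysectionP.
(* The sets [D i] cover the non-empty open set [W], so by Baire some [D i] is dense in an open [U].
   Then [G] contains [D i * J i], which is dense in [U * J i]. *)
pose D i := [set x | J i !=set0 /\ J i `<=` xsection G x].
have [i nDi] : exists i, ~ nowhere_dense (D i).
  apply: contrapT => nD.
  apply: (@nonmeager_open R W) => //; first exact: open_interior.
  apply: (@meager_countable_cover _ _ D) => [i|x Wx].
    by apply: contrapT => Di; apply: nD; exists i.
  have [||i Ji0 JiG] := Jpi (xsection G x)°; first exact: open_interior.
    by apply: Gx; exists y0; apply/xsectionP/ysectionP; exact: interior_subset.
  by exists i => //; split => //; apply: subset_trans JiG _; exact: interior_subset.
have [x Ux] : (closure (D i))° !=set0 by apply/set0P/eqP.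
have [z [[Ji0 _] _]] : D i `&` setT !=set0.
  by apply: (interior_subset Ux); exact: filterT.
exists (closure (D i))°, (J i); split=> //; first exact: open_interior.
  by exists x.
move=> O oO [[a b] Oab] OUJ.
have [Ua Jb] := OUJ _ Oab.
have [|a' [[_ Da'] Oa']] := interior_subset Ua (ysection O b).
  have [[A B] [/= An Bn] AB] : nbhs (a, b) O by exact: open_nbhs_nbhs.
  apply: filterS An => c Ac; apply/ysectionP/AB; split=> //=.
  exact: nbhs_singleton.
exists (a', b); split; first exact/ysectionP.
exact/xsectionP/Da'.
Qed.

Lemma cross_nowhere_dense_setXT (N : set R) :
  nowhere_dense N -> @nowhere_dense (cross_space C) (N `*` setT).
Proof.
move=> /nowhere_denseP Nnd; apply/cross_nowhere_denseP => G CG G0.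
have [CI _ _] := crossC.
have [U [V [oU oV U0 V0 denseG]]] := cross_dense_rectangle CG G0.
have /existsNP[x /not_implyP[Ux nNx]] := Nnd U oU U0.
(* Inside the rectangle where [G] is dense, [O] avoids the strip over [N]; being open in the product
   topology, it meets [G]. *)
have [||||O [CO oO O0 OUV]] := @cross_subrectangle (U `\` closure N) V => //.
- by rewrite setDE; apply: openI => //; apply: closed_openC; exact: closed_closure.
- by exists x.
exists (O `&` G); first exact: CI.
split.
- by apply: denseG => // p /OUV[[]].
- exact: subIsetr.
- apply/seteqP; split=> // p [[/OUV[[_ nN] _] _] [Np _]].
  by apply: nN; exact: subset_closure.
Qed.

Lemma cross_meager_fst (Z : set (R * R)) :
  meager (fst @` Z) -> @meager (cross_space C) Z.
Proof.
move=> [F [Fnd ZF]].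
apply: (@meager_countable_cover (cross_space C) _ (fun n => F n `*` setT)) => [n|p Zp].
  exact: cross_nowhere_dense_setXT.
have : (fst @` Z) p.1 by exists p.
by rewrite ZF => -[n _ Fp]; exists n.
Qed.

End cross.

(** * Squares of non-meager sets and the value of non *)

Lemma nowhere_dense_set1 (R : realType) (x : R) : nowhere_dense [set x].
Proof.
by rewrite /nowhere_dense -(closure_id _).1 ?interior_set1//; exact: closed1.
Qed.

Lemma nonmeager_infinite (R : realType) (X : set R) :
  ~ meager X -> infinite_set X.
Proof.
move=> nX /finite_seqP[s Xs]; apply: nX.
apply: (@meager_countable_cover _ _ (fun n => [set nth 0%R s n])) => [n|x].
  exact: nowhere_dense_set1.
by rewrite Xs => /= xs; exists (index x s) => //=; rewrite nth_index.
Qed.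

Unset Implicit Arguments.

Theorem theorem9 (R : realType) (C : set (set (R * R)))
  (crossC : cross_family C)
  (piC : exists2 P : set (set (R * R)), P `<=` C & pi_base P) :
  (forall X : set R, ~ @meager R X -> ~ @meager (cross_space C) (X `*` X)) /\
  (exists (Y : set (cross_space C)) (Y' : set R),
    [/\ attains_non (@meager (cross_space C)) Y,
        attains_non (@meager R) Y' &
        (Y #= Y')%card]).
Proof.
have sq (X : set R) : ~ meager X -> ~ @meager (cross_space C) (X `*` X).
  move=> nX mX; apply: (nX).
  (* Every vertical section of the square over a point of [X] is [X] itself, hence non-meager. *)
  apply: meager_sub (cross_meager_sections crossC piC mX) => x Xx /=.
  by rewrite in_xsectionX ?inE.
split=> //.
have nmT : ~ @meager R setT.
  by apply: nonmeager_open; [exact: openT|exists 0%R].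
have [|Y nY Ymin] := @card_le_min R [set X | ~ meager X]; first by exists setT.
have YY : Y `*` Y #= Y by apply: card_setX_infinite; exact: nonmeager_infinite.
exists (Y `*` Y), Y; split=> //; split=> //.
- apply/seteqP; split=> // p _; exists [set p] => //.
  apply: cross_meager_fst => //; exists (fun=> [set p.1]).
  split=> [_|]; first exact: nowhere_dense_set1.
  by rewrite image_set1 bigcup_const.
- exact: sq.
(* The first projection of [Z] is non-meager, so [Y] embeds into it, and it is no larger than
   [Z]. *)
- move=> Z nZ; rewrite (card_le_eql YY).
  apply: card_le_trans (card_image_le fst Z); apply: Ymin => mZ; apply: nZ.
  exact: cross_meager_fst.
- apply/seteqP; split=> // x _; exists [set x] => //; exists (fun=> [set x]).
  split=> [_|]; first exact: nowhere_dense_set1.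
  by rewrite bigcup_const.
Qed.
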